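(* Suppose that the $2\times 2$ biquadratic polynomial with real coefficients $$f(\mathbf x,\mathbf y)=a_{11}x_1^2y_1^2+a_{12}x_1^2y_2^2+a_{21}x_2^2y_1^2+a_{22}x_2^2y_2^2+bx_1x_2y_1y_2+c_{x1}x_1^2y_1y_2+c_{x2}x_2^2y_1y_2+c_{y1}x_1x_2y_1^2+c_{y2}x_1x_2y_2^2$$ is PSD. Then $a_{11},a_{12},a_{21},a_{22}\ge 0$ and $$4a_{11}a_{12}\ge c_{x1}^2,\quad 4a_{11}a_{21}\ge c_{y1}^2,\quad 4a_{12}a_{22}\ge c_{y2}^2,\quad 4a_{21}a_{22}\ge c_{x2}^2.$$ Furthermore, there is a $2\times 2$ PSD biquadratic polynomial $h$ with only two half-cross terms, of the form $$h(\mathbf x,\mathbf y)=\hat a_{11}x_1^2y_1^2+\hat a_{12}x_1^2y_2^2+\hat a_{21}x_2^2y_1^2+\hat a_{22}x_2^2y_2^2+\hat bx_1x_2y_1y_2+\hat c_{x1}x_1^2y_1y_2+\hat c_{y1}x_1x_2y_1^2,$$ with real coefficients, such that if $h$ has an SOS form, then an SOS form of $f$ can be obtained (i.e. $f$ is SOS).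
   Context: Here $\mathbf x=(x_1,x_2)^\top$, $\mathbf y=(y_1,y_2)^\top$. A real polynomial is PSD if it takes nonnegative values at all real points; it is SOS (has an SOS form) if it is a finite sum of squares of real polynomials. Half-cross terms are the terms in $x_1^2y_1y_2$, $x_2^2y_1y_2$, $x_1x_2y_1^2$, $x_1x_2y_2^2$ (coefficients are allowed to be zero). *)

(* Defs.v *)
From mathcomp Require Import all_boot all_order all_algebra.
From mathcomp Require Import reals.
From mathcomp Require Import mpoly.

Set Implicit Arguments.
Unset Strict Implicit.
Unset Printing Implicit Defensive.

Import Order.TTheory GRing.Theory Num.Theory.
Local Open Scope ring_scope.

Definition psd (R : realType) (n : nat) (p : {mpoly R[n]}) : Prop :=
  forall v : 'I_n -> R, 0 <= p.@[v].

Definition sos (R : realType) (n : nat) (p : {mpoly R[n]}) : Prop :=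
  exists s : seq {mpoly R[n]}, p = \sum_(q <- s) q ^+ 2.

(* The four indeterminates of {mpoly R[4]} are ordered x1, x2, y1, y2. *)
Definition X1 (R : realType) : {mpoly R[4]} := 'X_(@Ordinal 4 0 isT).
Definition X2 (R : realType) : {mpoly R[4]} := 'X_(@Ordinal 4 1 isT).
Definition Y1 (R : realType) : {mpoly R[4]} := 'X_(@Ordinal 4 2 isT).
Definition Y2 (R : realType) : {mpoly R[4]} := 'X_(@Ordinal 4 3 isT).

Arguments X1 {R}.
Arguments X2 {R}.
Arguments Y1 {R}.
Arguments Y2 {R}.

Definition biquad22 (R : realType)
    (a11 a12 a21 a22 b cx1 cx2 cy1 cy2 : R) : {mpoly R[4]} :=
  a11 *: (X1 ^+ 2 * Y1 ^+ 2) + a12 *: (X1 ^+ 2 * Y2 ^+ 2)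
  + a21 *: (X2 ^+ 2 * Y1 ^+ 2) + a22 *: (X2 ^+ 2 * Y2 ^+ 2)
  + b *: (X1 * X2 * Y1 * Y2)
  + cx1 *: (X1 ^+ 2 * Y1 * Y2) + cx2 *: (X2 ^+ 2 * Y1 * Y2)
  + cy1 *: (X1 * X2 * Y1 ^+ 2) + cy2 *: (X1 * X2 * Y2 ^+ 2).

Definition biquad22_two_half_cross (R : realType)
    (a11 a12 a21 a22 b cx1 cy1 : R) : {mpoly R[4]} :=
  a11 *: (X1 ^+ 2 * Y1 ^+ 2) + a12 *: (X1 ^+ 2 * Y2 ^+ 2)
  + a21 *: (X2 ^+ 2 * Y1 ^+ 2) + a22 *: (X2 ^+ 2 * Y2 ^+ 2)
  + b *: (X1 * X2 * Y1 * Y2)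
  + cx1 *: (X1 ^+ 2 * Y1 * Y2) + cy1 *: (X1 * X2 * Y1 ^+ 2).

(* Main.v *)
(* If f(e2,e2) = a22 > 0, the shear x2 -> x2 + s x1, y2 -> y2 + t y1 with s = - cy2 / (2 a22) and t = - cx2 / (2 a22) kills the half-cross terms x1 x2 y2^2 and x2^2 y1 y2; if a22 = 0, the discriminant inequalities already force cx2 = cy2 = 0. The shear is invertible, so it preserves nonnegativity and sums of squares in both directions. *)
Require Import Defs.
From mathcomp Require Import all_boot all_order all_algebra.
From mathcomp Require Import reals.
From mathcomp Require Import mpoly.
From mathcomp Require Import ring lra.
Import Order.TTheory GRing.Theory Num.Theory.
Local Open Scope ring_scope.

Lemma psd_binary_quadratic (R : realFieldType) (a c d : R) :
  (forall u v, 0 <= a * u ^+ 2 + c * u * v + d * v ^+ 2) ->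
  [/\ 0 <= a, 0 <= d & c ^+ 2 <= 4 * a * d].
Proof.
move=> q_ge0.
have a_ge0 : 0 <= a by have := q_ge0 1 0; lra.
have d_ge0 : 0 <= d by have := q_ge0 0 1; lra.
split=> //; have [a0|a_neq0] := eqVneq a 0.
  (* With [a = 0] the form takes the value [- c ^+ 2] at this point, which forces [c = 0]. *)
  by have := q_ge0 (- (d + 1)) c; rewrite a0; nra.
have a_gt0 : 0 < a by rewrite lt_def a_neq0.
(* At [(- c, 2 * a)] the form equals [a * (4 * a * d - c ^+ 2)], so the positive factor [a] can be
   divided out. *)
rewrite -subr_ge0 -(pmulr_rge0 _ a_gt0).
by have := q_ge0 (- c) (2 * a); congr (0 <= _); ring.
Qed.

Definition point4 {T : Type} (x1 x2 y1 y2 : T) (i : 'I_4) : T :=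
  nth y2 [:: x1; x2; y1; y2] i.

(** Coefficients and variables share an arbitrary commutative ring, so that the same expression
    serves for real values and, with constant polynomials as coefficients, inside [{mpoly R[4]}]. *)
Definition biquad22_eval {A : comNzRingType}
    (a11 a12 a21 a22 b cx1 cx2 cy1 cy2 x1 x2 y1 y2 : A) : A :=
  a11 * (x1 ^+ 2 * y1 ^+ 2) + a12 * (x1 ^+ 2 * y2 ^+ 2)
  + a21 * (x2 ^+ 2 * y1 ^+ 2) + a22 * (x2 ^+ 2 * y2 ^+ 2)
  + b * (x1 * x2 * y1 * y2)
  + cx1 * (x1 ^+ 2 * y1 * y2) + cx2 * (x2 ^+ 2 * y1 * y2)
  + cy1 * (x1 * x2 * y1 ^+ 2) + cy2 * (x1 * x2 * y2 ^+ 2).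

Lemma biquad22_eval_shear (A : comNzRingType)
    (a11 a12 a21 a22 b cx1 cx2 cy1 cy2 s t x1 x2 y1 y2 : A) :
  biquad22_eval a11 a12 a21 a22 b cx1 cx2 cy1 cy2
    x1 (x2 + s * x1) y1 (y2 + t * y1) =
  biquad22_eval
    (a11 + t ^+ 2 * a12 + s ^+ 2 * a21 + s ^+ 2 * t ^+ 2 * a22 + s * t * b
     + t * cx1 + s ^+ 2 * t * cx2 + s * cy1 + s * t ^+ 2 * cy2)
    (a12 + s ^+ 2 * a22 + s * cy2)
    (a21 + t ^+ 2 * a22 + t * cx2)
    a22
    (b + 4 * s * t * a22 + 2 * s * cx2 + 2 * t * cy2)
    (cx1 + 2 * t * a12 + 2 * s ^+ 2 * t * a22 + s * b + s ^+ 2 * cx2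
     + 2 * s * t * cy2)
    (cx2 + 2 * t * a22)
    (cy1 + 2 * s * a21 + 2 * s * t ^+ 2 * a22 + t * b + 2 * s * t * cx2
     + t ^+ 2 * cy2)
    (cy2 + 2 * s * a22)
    x1 x2 y1 y2.
Proof. by rewrite /biquad22_eval; ring. Qed.

Lemma meval_biquad22 (R : realType) (a11 a12 a21 a22 b cx1 cx2 cy1 cy2 : R)
    (v : 'I_4 -> R) :
  (biquad22 a11 a12 a21 a22 b cx1 cx2 cy1 cy2).@[v] =
  biquad22_eval a11 a12 a21 a22 b cx1 cx2 cy1 cy2
    (v (@Ordinal 4 0 isT)) (v (@Ordinal 4 1 isT))
    (v (@Ordinal 4 2 isT)) (v (@Ordinal 4 3 isT)).
Proof. by rewrite !(mevalD, mevalZ, mevalM, rmorphXn) /= !mevalXU. Qed.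

Lemma biquad22E (R : realType) (a11 a12 a21 a22 b cx1 cx2 cy1 cy2 : R) :
  biquad22 a11 a12 a21 a22 b cx1 cx2 cy1 cy2 =
  biquad22_eval a11%:MP a12%:MP a21%:MP a22%:MP b%:MP cx1%:MP cx2%:MP
    cy1%:MP cy2%:MP X1 X2 Y1 Y2.
Proof. by rewrite /biquad22_eval !mul_mpolyC. Qed.

Lemma biquad22_two_half_crossE (R : realType) (a11 a12 a21 a22 b cx1 cy1 : R) :
  biquad22_two_half_cross a11 a12 a21 a22 b cx1 cy1 =
  biquad22 a11 a12 a21 a22 b cx1 0 cy1 0.
Proof. by rewrite /biquad22 !scale0r !addr0. Qed.

Lemma comp_mpolyA (R : comNzRingType) (n k l : nat)
    (lq : n.-tuple {mpoly R[k]}) (lr : k.-tuple {mpoly R[l]})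
    (p : {mpoly R[n]}) :
  (p \mPo lq) \mPo lr = p \mPo [tuple of [seq q \mPo lr | q <- lq]].
Proof.
rewrite !(comp_mpolyE p) raddf_sum /=; apply: eq_bigr => m _.
rewrite comp_mpolyZ rmorph_prod; congr (_ *: _); apply: eq_bigr => i _.
by rewrite rmorphXn tnth_map.
Qed.

Lemma psd_comp_mpoly (R : realType) (n k : nat) (lq : n.-tuple {mpoly R[k]})
    (p : {mpoly R[n]}) :
  psd p -> psd (p \mPo lq).
Proof. by move=> p_psd v; rewrite comp_mpoly_meval. Qed.

Lemma sos_comp_mpoly (R : realType) (n k : nat) (lq : n.-tuple {mpoly R[k]})
    (p : {mpoly R[n]}) :
  sos p -> sos (p \mPo lq).
Proof.
case=> s ->; exists [seq q \mPo lq | q <- s].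
by rewrite rmorph_sum big_map; apply: eq_bigr => q _; rewrite rmorphXn.
Qed.

Definition shear {R : realType} (s t : R) : 4.-tuple {mpoly R[4]} :=
  [tuple X1; X2 + s *: X1; Y1; Y2 + t *: Y1].

Lemma comp_shear_biquad22 (R : realType)
    (a11 a12 a21 a22 b cx1 cx2 cy1 cy2 s t : R) :
  biquad22 a11 a12 a21 a22 b cx1 cx2 cy1 cy2 \mPo shear s t =
  biquad22
    (a11 + t ^+ 2 * a12 + s ^+ 2 * a21 + s ^+ 2 * t ^+ 2 * a22 + s * t * b
     + t * cx1 + s ^+ 2 * t * cx2 + s * cy1 + s * t ^+ 2 * cy2)
    (a12 + s ^+ 2 * a22 + s * cy2)
    (a21 + t ^+ 2 * a22 + t * cx2)
    a22
    (b + 4 * s * t * a22 + 2 * s * cx2 + 2 * t * cy2)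
    (cx1 + 2 * t * a12 + 2 * s ^+ 2 * t * a22 + s * b + s ^+ 2 * cx2
     + 2 * s * t * cy2)
    (cx2 + 2 * t * a22)
    (cy1 + 2 * s * a21 + 2 * s * t ^+ 2 * a22 + t * b + 2 * s * t * cx2
     + t ^+ 2 * cy2)
    (cy2 + 2 * s * a22).
Proof.
(* The constant embedding is a ring morphism. Pushing it through the new coefficients exposes the
   right-hand side of the shear identity, taken over [{mpoly R[4]}]. *)
rewrite [RHS]biquad22E !(mpolyCD, mpolyCM, rmorphXn, rmorph_nat) /=.
rewrite -biquad22_eval_shear /biquad22_eval !mul_mpolyC.
by rewrite !(comp_mpolyD, comp_mpolyZ, rmorphM, rmorphXn) /= !comp_mpolyXU.
Qed.

(** Both shears fix [X1] and [Y1], so the multiples of these added to [X2] and [Y2] cancel. It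
    suffices to compare the composed substitutions on the four indeterminates. *)
Lemma comp_shearK (R : realType) (s t : R) (p : {mpoly R[4]}) :
  (p \mPo shear s t) \mPo shear (- s) (- t) = p.
Proof.
rewrite comp_mpolyA -[RHS]comp_mpoly_id; congr (_ \mPo _).
apply: eq_from_tnth; case; do 4?case; last by [].
all: move=> lt_i4; rewrite tnth_map tnth_mktuple (tnth_nth 0) /=.
all: rewrite ?comp_mpolyD ?comp_mpolyZ !comp_mpolyXU /= ?scaleNr ?subrK.
all: by congr ('X_ _); apply: val_inj.
Qed.

Theorem theorem4p3 (R : realType)
    (a11 a12 a21 a22 b cx1 cx2 cy1 cy2 : R)
    (f_psd : psd (biquad22 a11 a12 a21 a22 b cx1 cx2 cy1 cy2)) :
  [/\ 0 <= a11, 0 <= a12, 0 <= a21 & 0 <= a22] /\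
  [/\ cx1 ^+ 2 <= 4 * a11 * a12, cy1 ^+ 2 <= 4 * a11 * a21,
      cy2 ^+ 2 <= 4 * a12 * a22 & cx2 ^+ 2 <= 4 * a21 * a22] /\
  exists ha11 ha12 ha21 ha22 hb hcx1 hcy1 : R,
    let h := biquad22_two_half_cross ha11 ha12 ha21 ha22 hb hcx1 hcy1 in
    psd h /\
    (sos h -> sos (biquad22 a11 a12 a21 a22 b cx1 cx2 cy1 cy2)).
Proof.
have f_ge0 x1 x2 y1 y2 :
    0 <= biquad22_eval a11 a12 a21 a22 b cx1 cx2 cy1 cy2 x1 x2 y1 y2.
  by have := f_psd (point4 x1 x2 y1 y2); rewrite meval_biquad22.
(* Setting one of the two vectors to a coordinate vector leaves a binary quadratic form in the
   other; the four choices give the four discriminant inequalities. *)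
have [] : [/\ 0 <= a11, 0 <= a12 & cx1 ^+ 2 <= 4 * a11 * a12].
  apply: psd_binary_quadratic => u v.
  by have := f_ge0 1 0 u v; rewrite /biquad22_eval; congr (0 <= _); ring.
have [] : [/\ 0 <= a11, 0 <= a21 & cy1 ^+ 2 <= 4 * a11 * a21].
  apply: psd_binary_quadratic => u v.
  by have := f_ge0 u v 1 0; rewrite /biquad22_eval; congr (0 <= _); ring.
have [] : [/\ 0 <= a12, 0 <= a22 & cy2 ^+ 2 <= 4 * a12 * a22].
  apply: psd_binary_quadratic => u v.
  by have := f_ge0 u v 0 1; rewrite /biquad22_eval; congr (0 <= _); ring.
have [] : [/\ 0 <= a21, 0 <= a22 & cx2 ^+ 2 <= 4 * a21 * a22].
  apply: psd_binary_quadratic => u v.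
  by have := f_ge0 0 1 u v; rewrite /biquad22_eval; congr (0 <= _); ring.
move=> _ a22_ge0 cx2_le _ _ cy2_le _ a21_ge0 cy1_le a11_ge0 a12_ge0 cx1_le.
do 2!split=> //.
(* For [a22 = 0] the bound gives [c = 0], and the quotient by zero is harmless since it is
   multiplied by [a22]. No case split on [a22] is then needed for the shear. *)
have cancel (c d : R) :
    c ^+ 2 <= 4 * d * a22 -> c + 2 * (- c / (2 * a22)) * a22 = 0.
  have [->|a22_neq0 _] := eqVneq a22 0; last by field.
  by rewrite !mulr0 addr0; nra.
pose s := - cy2 / (2 * a22); pose t := - cx2 / (2 * a22).
have := @comp_shear_biquad22 R a11 a12 a21 a22 b cx1 cx2 cy1 cy2 s t.
rewrite (cancel _ _ cx2_le) (cancel _ _ cy2_le) -biquad22_two_half_crossE => hE.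
have h_psd := psd_comp_mpoly _ _ _ (shear s t) _ f_psd.
(* The inverse shear carries a sum of squares for the sheared polynomial back to one for the
   original. *)
have h_sos := sos_comp_mpoly _ _ _ (shear (- s) (- t))
  (biquad22 a11 a12 a21 a22 b cx1 cx2 cy1 cy2 \mPo shear s t).
rewrite comp_shearK in h_sos.
rewrite hE in h_psd h_sos.
(* Unification reads the seven coefficients of [h] off the sheared polynomial. *)
by do 7!eexists; split; [exact: h_psd | exact: h_sos].
Qed.
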